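(* Let $\{\omega_t=(S_t,\sigma_t)\}_{t\ge 0}$ be the mixer chain on $\mathbb{Z}$, and let $D_t$ be the distance of $\omega_t$ from the identity $(0,\mathrm{id})$ in the group $\mathbb{Z}\ltimes\Sigma$ with respect to the generating set $\Upsilon=\{(1,\mathrm{id}),(-1,\mathrm{id}),(0,\langle 0,1\rangle),(0,\langle 0,-1\rangle)\}$. Then there exist constants $c,C>0$ such that for all integers $t\ge 0$, $$c\,t^{3/4}\le \mathbb{E}[D_t]\le C\,t^{3/4}.$$
   Context: Let $\Sigma$ be the group of all permutations $\sigma$ of $\mathbb{Z}$ with finite support, where the support of $\sigma$ is $\{x\in\mathbb{Z}:\sigma(x)\ne x\}$; multiplication is composition of functions. $\langle x,y\rangle$ denotes the transposition of $x$ and $y$, and $\mathrm{id}$ the identity permutation. For $x\in\mathbb{Z}$, also write $\phi_x$ for the translation $h\mapsto x+h$ of $\mathbb{Z}$; $\phi_x\tau\phi_x^{-1}\in\Sigma$ for $\tau\in\Sigma$. The group $\mathbb{Z}\ltimes\Sigma$ is the set $\mathbb{Z}\times\Sigma$ with multiplication $(x,\sigma)(y,\tau)=(x+y,\ \phi_x\tau\phi_x^{-1}\sigma)$ and identity $(0,\mathrm{id})$. It is generated by the symmetric set $\Upsilon=\{(1,\mathrm{id}),(-1,\mathrm{id}),(0,\langle 0,1\rangle),(0,\langle 0,-1\rangle)\}$. The mixer chain on $\mathbb{Z}$ is the random walk on $\mathbb{Z}\ltimes\Sigma$ with uniform step distribution on $\Upsilon$: $\omega_0=(0,\mathrm{id})$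 and $\omega_{t+1}=\omega_t\upsilon_{t+1}$, where $\upsilon_1,\upsilon_2,\dots$ are i.i.d. uniform on $\Upsilon$. (Thus $S_t$ is the position of the mixer and $\sigma_t(z)$ the position of the tile marked $z$; at each step the mixer picks a uniformly random neighbor of its position and, with probability $1/2$ each, moves there or swaps the tile at its position with the tile at that neighbor.) The distance between $a,b\in\mathbb{Z}\ltimes\Sigma$ with respect to $\Upsilon$ is the minimal $k$ such that $a^{-1}b$ is a product of $k$ elements of $\Upsilon$. *)

(* Defs.v *)
From HB Require Import structures.
From mathcomp Require Import all_boot all_order all_algebra finmap.
From mathcomp Require Import zify.
From mathcomp Require Import all_classical all_reals all_analysis.

Set Implicit Arguments.
Unset Strict Implicit.
Unset Printing Implicit Defensive.

Import Order.TTheory GRing.Theory Num.Theory.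

Local Open Scope classical_set_scope.
Local Open Scope ring_scope.

Record fsperm := FSPerm {
  fsperm_fun :> int -> int;
  fsperm_bij : bijective fsperm_fun;
  fsperm_fin : finite_set [set x | fsperm_fun x != x] }.

HB.instance Definition _ := gen_eqMixin fsperm.
HB.instance Definition _ := gen_choiceMixin fsperm.

Lemma fspermP (s t : fsperm) : s =1 t -> s = t.
Proof.
case: s t => [f fb ff] [g gb gf] /= /funext fg; move: fb ff.
by rewrite fg => fb ff; congr FSPerm; exact: Prop_irrelevance.
Qed.

Lemma fsperm_id_fin : finite_set [set x : int | id x != x].
Proof.
rewrite (_ : mkset _ = set0); first exact: finite_set0.
by apply/seteqP; split => x //=; rewrite eqxx.
Qed.

Definition fsperm_one : fsperm :=
  FSPerm (Bijective (fun=> erefl) (fun=> erefl)) fsperm_id_fin.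

Lemma fsperm_mul_fin (s t : fsperm) : finite_set [set x | (s \o t) x != x].
Proof.
apply: (@sub_finite_set _ _ ([set x | s x != x] `|` [set x | t x != x])).
  move=> x /= stx; have [tx|tx] := eqVneq (t x) x; last by right.
  by left; move: stx; rewrite tx.
by rewrite finite_setU; split; exact: fsperm_fin.
Qed.

(* As for functions, [(s * t) x = s (t x)]; finite groups of permutations in
   the library use the opposite convention. *)
Definition fsperm_mul (s t : fsperm) : fsperm :=
  FSPerm (bij_comp (fsperm_bij s) (fsperm_bij t)) (fsperm_mul_fin s t).

Lemma fsperm_inv_ex (s : fsperm) :
  exists t : fsperm, cancel s t /\ cancel t s.
Proof.
case: s => f [g fK gK] ff /=.
have gf : finite_set [set x | g x != x].
  apply: sub_finite_set ff => x /=; apply: contra_neq => fx.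
  by rewrite -{1}fx fK.
by exists (FSPerm (Bijective gK fK) gf).
Qed.

Definition fsperm_inv (s : fsperm) : fsperm := projT1 (cid (fsperm_inv_ex s)).

Lemma fsperm_invK (s : fsperm) : cancel s (fsperm_inv s).
Proof. by rewrite /fsperm_inv; case: cid => t []. Qed.

Lemma fsperm_invVK (s : fsperm) : cancel (fsperm_inv s) s.
Proof. by rewrite /fsperm_inv; case: cid => t []. Qed.

Lemma fsperm_mulA : associative fsperm_mul.
Proof. by move=> s t u; exact: fspermP. Qed.

Lemma fsperm_mul1 : left_id fsperm_one fsperm_mul.
Proof. by move=> s; exact: fspermP. Qed.

Lemma fsperm_mulr1 : right_id fsperm_one fsperm_mul.
Proof. by move=> s; exact: fspermP. Qed.

Lemma fsperm_mulV : left_inverse fsperm_one fsperm_inv fsperm_mul.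
Proof. by move=> s; apply: fspermP => x; exact: fsperm_invK. Qed.

Lemma fsperm_mulrV : right_inverse fsperm_one fsperm_inv fsperm_mul.
Proof. by move=> s; apply: fspermP => x; exact: fsperm_invVK. Qed.

HB.instance Definition _ := isGroup.Build fsperm
  fsperm_mulA fsperm_mul1 fsperm_mulr1 fsperm_mulV fsperm_mulrV.

Definition transp_fun (x y z : int) : int :=
  if z == x then y else if z == y then x else z.

Lemma transp_funK x y : involutive (transp_fun x y).
Proof.
move=> z; rewrite /transp_fun.
by have [->|zx] := eqVneq z x; [case: eqVneq; rewrite ?eqxx|
  have [->|zy] := eqVneq z y; rewrite ?eqxx // (negbTE zx) (negbTE zy)].
Qed.

Lemma transp_fin x y : finite_set [set z | transp_fun x y z != z].
Proof.
apply: (@sub_finite_set _ _ [set x; y]) => [z /=|]; last exact: finite_set2.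
rewrite /transp_fun; have [->|_] := eqVneq z x; first by left.
by have [->|_] := eqVneq z y; [right | rewrite eqxx].
Qed.

Definition fstransp (x y : int) : fsperm :=
  FSPerm (inv_bij (@transp_funK x y)) (transp_fin x y).

Definition translation (x h : int) : int := x + h.

Lemma conj_translation_bij (x : int) (s : fsperm) :
  bijective (translation x \o s \o translation (- x)).
Proof.
exists (translation x \o fsperm_inv s \o translation (- x)) => h;
  by rewrite /translation /= addKr ?fsperm_invK ?fsperm_invVK addNKr.
Qed.

Lemma conj_translation_fin (x : int) (s : fsperm) :
  finite_set [set h | (translation x \o s \o translation (- x)) h != h].
Proof.
apply: sub_finite_set (finite_image (translation x) (fsperm_fin s)) => h /= sh.
exists (- x + h); last by rewrite /translation addNKr.
by apply: contra_neq sh => sh; rewrite /translation sh addNKr.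
Qed.

Definition conj_translation (x : int) (s : fsperm) : fsperm :=
  FSPerm (conj_translation_bij x s) (conj_translation_fin x s).

Record mixer_group := Mixer { mixer_pos : int; mixer_tiles : fsperm }.

HB.instance Definition _ := gen_eqMixin mixer_group.
HB.instance Definition _ := gen_choiceMixin mixer_group.

Definition mixer_one : mixer_group := Mixer 0 1%g.

Definition mixer_mul (a b : mixer_group) : mixer_group :=
  Mixer (mixer_pos a + mixer_pos b)
        (conj_translation (mixer_pos a) (mixer_tiles b) * mixer_tiles a)%g.

Definition mixer_inv (a : mixer_group) : mixer_group :=
  Mixer (- mixer_pos a) (conj_translation (- mixer_pos a) (mixer_tiles a)^-1%g).

Lemma mixer_mulA : associative mixer_mul.
Proof.
move=> [x s] [y t] [z u]; rewrite /mixer_mul /= addrA; congr Mixer.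
apply: fspermP => h /=; rewrite /translation -[in RHS]addrA.
by do 2![congr (_ + _)]; congr (u _); lia.
Qed.

Lemma mixer_mul1 : left_id mixer_one mixer_mul.
Proof.
move=> [x s]; rewrite /mixer_mul /= add0r; congr Mixer.
by apply: fspermP => h /=; rewrite /translation oppr0 !add0r.
Qed.

Lemma mixer_mulr1 : right_id mixer_one mixer_mul.
Proof.
move=> [x s]; rewrite /mixer_mul /= addr0; congr Mixer.
by apply: fspermP => h /=; rewrite /translation addNKr.
Qed.

Lemma mixer_mulV : left_inverse mixer_one mixer_inv mixer_mul.
Proof.
move=> [x s]; rewrite /mixer_mul /= addNr; congr Mixer.
by apply: fspermP => h /=; rewrite /translation opprK !addNKr ?addKr
  fsperm_invVK addKr.
Qed.

Lemma mixer_mulrV : right_inverse mixer_one mixer_inv mixer_mul.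
Proof.
move=> [x s]; rewrite /mixer_mul /= addrN; congr Mixer.
by apply: fspermP => h /=; rewrite /translation opprK !addNKr fsperm_invK.
Qed.

HB.instance Definition _ := isGroup.Build mixer_group
  mixer_mulA mixer_mul1 mixer_mulr1 mixer_mulV mixer_mulrV.

Lemma mixer_mulE (x y : int) (s t : fsperm) :
  (Mixer x s * Mixer y t)%g = Mixer (x + y) (conj_translation x t * s)%g.
Proof. by []. Qed.

HB.instance Definition _ := isPointed.Build mixer_group 1%g.

(* The group is countable, hence every subset is taken to be measurable. *)
HB.instance Definition _ := @isMeasurable.Build default_measure_display
  mixer_group discrete_measurable discrete_measurable0
  discrete_measurableC discrete_measurableU.

Definition Upsilon : seq mixer_group :=
  [:: Mixer 1 1%g; Mixer (-1) 1%g;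
      Mixer 0 (fstransp 0 1); Mixer 0 (fstransp 0 (-1))].

Definition is_word (k : nat) (g : mixer_group) : Prop :=
  exists s : seq mixer_group,
    [/\ size s = k, {subset s <= Upsilon} & g = (\prod_(u <- s) u)%g].

Lemma is_word_mul k l g h : is_word k g -> is_word l h -> is_word (k + l) (g * h)%g.
Proof.
move=> [s [<- sU ->]] [t [<- tU ->]]; exists (s ++ t).
rewrite size_cat big_cat; split => // u; rewrite mem_cat.
by case/orP; [exact: sU|exact: tU].
Qed.

Lemma is_word_gen u : u \in Upsilon -> is_word 1 u.
Proof.
by move=> uU; exists [:: u]; rewrite big_seq1; split => // v; rewrite inE => /eqP ->.
Qed.

Lemma generated_pos (x : int) : exists k, is_word k (Mixer x 1%g).
Proof.
have E (y z : int) : (Mixer y 1 * Mixer z 1)%g = Mixer (y + z) 1%g.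
  by rewrite mixer_mulE; congr Mixer; apply: fspermP => h /=;
    rewrite /translation addNKr.
elim: x => [|n [k nk]|n [k nk]].
- by exists 0%N, [::]; rewrite big_nil.
- exists (k + 1)%N; rewrite intS addrC -E.
  by apply: is_word_mul => //; apply: is_word_gen; rewrite !inE eqxx.
- exists (k + 1)%N; rewrite intS opprD addrC -E.
  by apply: is_word_mul => //; apply: is_word_gen; rewrite !inE eqxx orbT.
Qed.

Lemma generated_adj (x : int) : exists k, is_word k (Mixer 0 (fstransp x (x + 1))).
Proof.
have [k kx] := generated_pos x; have [l lx] := generated_pos (- x).
exists (k + 1 + l)%N.
have -> : Mixer 0 (fstransp x (x + 1)) =
    (Mixer x 1 * Mixer 0 (fstransp 0 1) * Mixer (- x) 1)%g.
  rewrite !mixer_mulE addr0 addrN; congr Mixer.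
  apply: fspermP => h /=; rewrite /translation addNKr /transp_fun.
  by do ![case: eqVneq => //= ?]; lia.
apply: is_word_mul lx; apply: is_word_mul kx _.
by apply: is_word_gen; rewrite !inE eqxx !orbT.
Qed.

Lemma generated_tiles_aux (a : int) (n : nat) (s : fsperm) :
  (forall z : int, ~~ (a <= z < a + n%:Z) -> s z = z) ->
  exists k, is_word k (Mixer 0 s).
Proof.
elim: n s => [|n IHn] s sfix.
  exists 0%N, [::]; rewrite big_nil; split => //; congr Mixer.
  by apply: fspermP => z; apply: sfix; lia.
have si : injective s := bij_inj (fsperm_bij s).
have sm : a <= s (a + n%:Z) <= a + n%:Z.
  apply: contraT => H; have E : s (s (a + n%:Z)) = s (a + n%:Z).
    by apply: sfix; lia.
  by move/si: E => E; lia.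
have [d dE] : exists d : nat, s (a + n%:Z) = a + n%:Z - d%:Z.
  by exists (absz (a + n%:Z - s (a + n%:Z))%R); lia.
elim: d s sfix si sm dE => [|d IHd] s sfix si sm dE.
  apply: IHn => z; have [->|zm] := eqVneq z (a + n%:Z); first by rewrite dE subr0.
  by move=> H; apply: sfix; lia.
set w := s (a + n%:Z) in sm dE.
have [|||//|k kP] := IHd (fstransp w (w + 1) * s)%g.
- move=> z zH; rewrite /= sfix // /transp_fun.
  by do ![case: eqVneq => //= ?]; lia.
- exact: bij_inj (fsperm_bij _).
- by rewrite /= -/w /transp_fun eqxx; lia.
- by rewrite /= -/w /transp_fun eqxx dE; lia.
have [l lP] := generated_adj w.
exists (k + l)%N.
suff -> : Mixer 0 s =
    (Mixer 0 (fstransp w (w + 1) * s) * Mixer 0 (fstransp w (w + 1)))%g.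
  exact: is_word_mul.
rewrite !mixer_mulE addr0; congr Mixer.
by apply: fspermP => h /=; rewrite /translation oppr0 !add0r transp_funK.
Qed.

Lemma generated (g : mixer_group) : exists k, `[< is_word k g >].
Proof.
case: g => x s.
have [l lP] : exists l, is_word l (Mixer 0 s).
  have /finite_seqP[r rE] := fsperm_fin s.
  pose N := \max_(z <- r) `|z|%N.
  apply: (@generated_tiles_aux (- N%:Z) (N + N + 1)) => z zN.
  apply: contraNeq zN => sz.
  have zr : z \in r by have : [set` r] z by rewrite -rE.
  have : (`|z| <= N)%N by rewrite /N (big_rem z zr) /= leq_maxl.
  by lia.
have [k kP] := generated_pos x.
exists (l + k)%N; apply/asboolP.
suff -> : Mixer x s = (Mixer 0 s * Mixer x 1)%g by exact: is_word_mul.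
rewrite !mixer_mulE add0r; congr Mixer.
by apply: fspermP => h /=; rewrite /translation addNKr.
Qed.

Definition mixer_dist (a b : mixer_group) : nat :=
  ex_minn (generated (a^-1 * b)%g).

Section mixer_chain.
Context d (T : measurableType d) (R : realType) (P : probability T R).

Definition mutually_independent (X : nat -> {RV P >-> mixer_group}) : Prop :=
  forall (J : {fset nat}) (A : nat -> set mixer_group),
    (forall j, measurable (A j)) ->
    P (\bigcap_(j in [set` J]) X j @^-1` A j) =
    (\prod_(j <- J) P (X j @^-1` A j))%E.

Definition uniform_on_Upsilon (X : {RV P >-> mixer_group}) : Prop :=
  forall u, u \in Upsilon -> distribution P X [set u] = (4^-1)%:E.

(* [upsilon t] is the step taken from time [t] to time [t.+1]. *)
Definition mixer_chain (omega : nat -> T -> mixer_group) : Prop :=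
  exists upsilon : nat -> {RV P >-> mixer_group},
    [/\ mutually_independent upsilon,
        forall t, uniform_on_Upsilon (upsilon t),
        forall w, omega 0 w = 1%g &
        forall t w, omega t.+1 w = (omega t w * upsilon t w)%g].

End mixer_chain.

(* Main.v *)
Require Import Defs.
From mathcomp Require Import all_boot all_order all_algebra finmap.
From mathcomp Require Import zify ring lra.
From mathcomp Require Import all_classical all_reals all_analysis.
From mathcomp Require Import measurable_realfun.

(* Up to constants, the distance from [(x, s)] to the identity is the total
   displacement [\sum_z |s z - z|] plus at most the range of the mixer: each
   generator moves at most two tiles by one step, and conversely insertion sort
   uses at most [\sum_z |s z - z|] carries.

   For a single tile [z] at position [p], put [X = 2 (p - z) + sg (x - p) + sg z]
   and [k = |x - p|].  Then [(X, k)] is a Markov chain: [X] moves by a fair sign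
   exactly when [k] jumps between 0 and 1.  With [phi k = k + 3/4 [k = 0]], the
   process [X^2 - 4 phi k] is a martingale and [X^4 - 24 X^2 phi k] a
   supermartingale.  Since [k] is of order [sqrt t] in the second and fourth
   moments, [E X^2 >= c sqrt t] and [E X^4 <= C t] when [|z| <= c sqrt t], whence
   [E |X| >= c t^(1/4)]; summing over about [sqrt t] tiles gives the lower bound.

   For the upper bound, [\sum_z E X_z^2 <= 2 t], since one step acts on at most
   three tiles, and [E M^2 <= 2 t] for the maximum [M] of [|x|]; as only the
   tiles [|z| <= M + 1] have moved, AM-GM with weight [t^(1/4)] gives
   [E \sum_z |X_z| <= C t^(3/4)]. *)

Set Implicit Arguments.
Unset Strict Implicit.
Unset Printing Implicit Defensive.
Import Order.TTheory GRing.Theory Num.Theory.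
Local Open Scope classical_set_scope.
Local Open Scope ring_scope.

(** * Averages along a four-step walk *)

Section walk_mean.
Context {R : realFieldType} {A : eqType}.
Implicit Types (next : A -> 4.-tuple A) (F G : A -> R) (a : A) (t : nat).

(** Successors are listed with multiplicity, since several generators may lead to the same state. *)
Definition step_mean next F a : R := 4^-1 * \sum_(b <- next a) F b.

Definition walk_mean next t F : A -> R := iter t (step_mean next) F.

Variable next : A -> 4.-tuple A.
Local Notation L := (step_mean next).
Local Notation W := (walk_mean next).

Lemma walk_meanSr t F : W t.+1 F = W t (L F).
Proof. exact: iterSr. Qed.

Lemma eq_step_mean F G : F =1 G -> L F =1 L G.
Proof. by move=> FG a; rewrite /step_mean; under eq_bigr do rewrite FG. Qed.

Lemma eq_walk_mean t F G : F =1 G -> W t F =1 W t G.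
Proof. by move=> FG; elim: t => //= t IH; exact: eq_step_mean. Qed.

Lemma walk_meanD t F G a : W t (fun b => F b + G b) a = W t F a + W t G a.
Proof.
elim: t a => //= t IH a; rewrite (eq_step_mean IH) /step_mean.
by rewrite big_split mulrDr.
Qed.

Lemma walk_meanZ t c F a : W t (fun b => c * F b) a = c * W t F a.
Proof.
elim: t a => //= t IH a; rewrite (eq_step_mean IH) /step_mean.
by rewrite -mulr_sumr mulrCA.
Qed.

Lemma walk_mean_cst t c a : W t (fun=> c) a = c.
Proof.
elim: t a => //= t IH a; rewrite (eq_step_mean IH) /step_mean.
rewrite big_const_seq count_predT size_tuple /= addr0.
by field.
Qed.

Lemma walk_mean_sum (I : Type) (s : seq I) t (F : I -> A -> R) a :
  W t (fun b => \sum_(i <- s) F i b) a = \sum_(i <- s) W t (F i) a.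
Proof.
elim: s => [|i s IH].
  rewrite big_nil -[RHS](walk_mean_cst t 0 a).
  by apply: eq_walk_mean => b; rewrite big_nil.
rewrite big_cons -IH -walk_meanD.
by apply: eq_walk_mean => b; rewrite big_cons.
Qed.

Section reachable.
Variable I : nat -> A -> Prop.
Hypothesis I_next : forall s a b, I s a -> b \in next a -> I s.+1 b.

(** Peeling off the last step keeps the start [a] fixed: [L F] and [L G] are then compared on states
    satisfying [I t], whose successors satisfy [I t.+1]. *)
Lemma walk_mean_le_in F G a t : (forall b, I t b -> F b <= G b) ->
  I 0%N a -> W t F a <= W t G a.
Proof.
elim: t F G => [|t IH] F G FG Ia; first exact: FG.
rewrite !walk_meanSr; apply: IH => // b Ib.
rewrite /step_mean ler_wpM2l ?invr_ge0 ?ler0n // big_seq [leRHS]big_seq.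
by apply: ler_sum => c /(I_next Ib) /FG.
Qed.

Lemma walk_mean_drift_le_in F c a t :
  (forall s b, I s b -> L F b <= F b + c) ->
  I 0%N a -> W t F a <= F a + c * t%:R.
Proof.
move=> LF Ia; elim: t => [|t IH]; first by rewrite /= mulr0 addr0.
rewrite walk_meanSr.
have /le_trans -> // : W t (L F) a <= W t (fun b => F b + c) a.
  by apply: walk_mean_le_in => // b /LF.
by rewrite walk_meanD walk_mean_cst -natr1 mulrDr mulr1 addrA lerD2r.
Qed.

Lemma walk_mean_drift_ge_in F c a t :
  (forall s b, I s b -> F b + c <= L F b) ->
  I 0%N a -> F a + c * t%:R <= W t F a.
Proof.
move=> LF Ia; have /= := @walk_mean_drift_le_in (fun b => -1 * F b) (- c) a t.
rewrite walk_meanZ => H; suff : -1 * W t F a <= -1 * F a + - c * t%:R by lra.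
apply: H => // s b /LF.
have := walk_meanZ 1 (-1) F b; rewrite /walk_mean /= => ->; lra.
Qed.

End reachable.

Lemma walk_mean_le F G a t : (forall b, F b <= G b) -> W t F a <= W t G a.
Proof. by move=> FG; apply: (@walk_mean_le_in (fun _ _ => True)). Qed.

Lemma walk_mean_drift_le F c a t :
  (forall b, L F b <= F b + c) -> W t F a <= F a + c * t%:R.
Proof. by move=> LF; apply: (@walk_mean_drift_le_in (fun _ _ => True)). Qed.

Lemma walk_mean_drift_ge F c a t :
  (forall b, F b + c <= L F b) -> F a + c * t%:R <= W t F a.
Proof. by move=> LF; apply: (@walk_mean_drift_ge_in (fun _ _ => True)). Qed.

End walk_mean.

(** Lumpability is asked of averages only, so the successors may be listed in different orders. *)
Lemma walk_mean_lump (R : realFieldType) (A B : eqType) (p : A -> B)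
    (nextA : A -> 4.-tuple A) (nextB : B -> 4.-tuple B) :
    (forall (F : B -> R) a,
      step_mean nextA (F \o p) a = step_mean nextB F (p a)) ->
  forall (F : B -> R) t a,
    walk_mean nextA t (F \o p) a = walk_mean nextB t F (p a).
Proof.
move=> AB F; elim=> // t IH a /=.
by rewrite -AB; exact: eq_step_mean.
Qed.

(** * The motion of one tile relative to the mixer *)

(** Here [k] is the distance from the mixer to the tile. At [k = 1] the mixer steps onto the tile or
    swaps it in, with opposite effects on [x]; the swap away from the tile does nothing to it. *)
Definition tile_next (a : int * nat) : 4.-tuple (int * nat) :=
  let: (x, k) := a in
  match k with
  | 0 => [tuple (x + 1, 1%N); (x - 1, 1%N); (x + 1, 1%N); (x - 1, 1%N)]
  | 1 => [tuple (x + 1, 0%N); (x - 1, 0%N); (x, 2); (x, 1%N)]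
  | k'.+2 => [tuple (x, k.+1); (x, k'.+1); (x, k); (x, k)]
  end.

Section tile_moments.
Variable R : realFieldType.
Local Notation W := (@walk_mean R (int * nat)%type tile_next).
Local Notation L := (@step_mean R (int * nat)%type tile_next).

Let X (a : int * nat) : R := a.1%:~R.
Let K (a : int * nat) : R := a.2%:R.
(** The value 3/4 at 0 gives [4 phi] the drift of [X^2]: 1 at [k = 0], 1/2 at [k = 1], 0 beyond. *)
Let phi (a : int * nat) : R := if a.2 is 0 then 3 / 4 else a.2%:R.

Lemma tile_step_meanE (F : int * nat -> R) x k : L F (x, k) =
  match k with
  | 0 => 2^-1 * (F (x + 1, 1%N) + F (x - 1, 1%N))
  | 1 => 4^-1 * (F (x + 1, 0%N) + F (x - 1, 0%N) + F (x, 2) + F (x, 1%N))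
  | k'.+2 => 4^-1 * (F (x, k.+1) + F (x, k'.+1) + 2 * F (x, k))
  end.
Proof.
rewrite /step_mean; case: k => [|[|k]] /=; rewrite !big_cons big_nil; by field.
Qed.

Let natE k : (k.+1%:R = k%:R + 1 :> R) * (k.+2%:R = k%:R + 2 :> R) *
  (k.+3%:R = k%:R + 3 :> R).
Proof. by rewrite -[k.+3]addn3 -[k.+2]addn2 -[k.+1]addn1 !natrD. Qed.

Ltac expand := rewrite tile_step_meanE /= ?[(_ + 1)%:~R]rmorphD ?[(_ - 1)%:~R]rmorphB
  ?rmorph1 /=.

(** The drift of [K^2] is 1 at [k = 0], 1/4 at [k = 1] and 1/2 beyond. *)
Lemma tile_K2_ge t a : K a ^+ 2 + 4^-1 * t%:R <= W t (fun b => K b ^+ 2) a.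
Proof.
apply: (@walk_mean_drift_ge _ _ _ (fun b => K b ^+ 2)) => -[x [|[|k]]].
- by expand; rewrite /K /=; lra.
- by expand; rewrite /K /=; lra.
- by expand; rewrite /K /=; lra.
Qed.

Lemma tile_K2_le t a : W t (fun b => K b ^+ 2) a <= K a ^+ 2 + t%:R.
Proof.
rewrite -[t%:R]mul1r.
apply: (@walk_mean_drift_le _ _ _ (fun b => K b ^+ 2)) => -[x [|[|k]]].
- by expand; rewrite /K /=; lra.
- by expand; rewrite /K /=; lra.
- by expand; rewrite /K /=; lra.
Qed.

(** The drift of [K^4] is at most [3 K^2 + 1], whose mean [tile_K2_le] controls. *)
Lemma tile_K4_le t a : W t (fun b => K b ^+ 4) a <=
  K a ^+ 4 + 3 * K a ^+ 2 * t%:R + 3 * t%:R ^+ 2.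
Proof.
elim: t => [|t IH]; first by rewrite /= expr0n !mulr0 !addr0.
rewrite walk_meanSr.
have /le_trans -> // : W t (L (fun b => K b ^+ 4)) a <=
    W t (fun b => K b ^+ 4 + (3 * K b ^+ 2 + 1)) a.
  apply: walk_mean_le => -[x [|[|k]]].
  - by expand; rewrite /K /=; lra.
  - by expand; rewrite /K /=; lra.
  - by expand; rewrite /K /=; lra.
rewrite !walk_meanD walk_meanZ walk_mean_cst -natr1.
have := tile_K2_le t a; have : 0 <= t%:R :> R by rewrite ler0n.
by nra.
Qed.

Lemma tile_X2 t a :
  W t (fun b => X b ^+ 2) a - X a ^+ 2 = 4 * (W t phi a - phi a).
Proof.
pose h b := X b ^+ 2 + - 4 * phi b.
have Lh b : L h b = h b.
  by case: b => x [|[|k]]; rewrite /h /X /phi; expand; field.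
have hE : W t h a = h a.
  by elim: t => // t IH; rewrite walk_meanSr (eq_walk_mean _ _ Lh).
by move: hE; rewrite /h walk_meanD walk_meanZ; lra.
Qed.

(** With [h = X^4 - 24 X^2 phi], completing the square gives
    [X^4 = 2 h + 576 phi^2 - (X^2 - 24 phi)^2]; [h] is a supermartingale that starts at 0. *)
Lemma tile_X4_le t k :
  W t (fun b => X b ^+ 4) (0, k) <= 576 * (k%:R ^+ 2 + t%:R + 1).
Proof.
pose h b := X b ^+ 4 + - 24 * (X b ^+ 2 * phi b).
have hle : W t h (0, k) <= 0.
  have -> : 0 = h (0, k) + 0 * t%:R by rewrite /h /X /= mul0r expr0n /=; lra.
  apply: walk_mean_drift_le => -[x {}k]; rewrite /h /X /phi.
  by case: k => [|[|k]]; expand; lra.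
have : W t (fun b => X b ^+ 4) (0, k) <=
    W t (fun b => 2 * h b + 576 * (K b ^+ 2 + 1)) (0, k).
  apply: walk_mean_le => -[x j]; rewrite /h /K /= -/(X (x, j)).
  have phi2 : phi (x, j) ^+ 2 <= j%:R ^+ 2 + 1.
    by rewrite /phi /=; case: j => [|j]; rewrite ?expr0n /=; lra.
  have := sqr_ge0 (X (x, j) ^+ 2 - 24 * phi (x, j)).
  move: phi2; set y := X _; set p := phi _; nra.
rewrite walk_meanD !walk_meanZ (walk_meanD _ _ (fun b => K b ^+ 2)) walk_mean_cst.
by have := tile_K2_le t (0, k); rewrite /K /=; lra.
Qed.

(* [2 u - 3 u^2 + u^4 = u (u - 1)^2 (u + 2)] at [u = `|x| / m]. *)
Lemma norm_ge_moments (x m : R) : 0 <= m ->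
  3 * m ^+ 2 * x ^+ 2 - x ^+ 4 <= 2 * m ^+ 3 * `|x|.
Proof.
move=> m0; rewrite -(real_normK (num_real x)).
rewrite -[x ^+ 4]/(x ^+ (2 * 2)) exprM -(real_normK (num_real x)).
move: `|x| (normr_ge0 x) => y y0.
rewrite -subr_ge0 [leRHS](_ : _ = y * (y - m) ^+ 2 * (y + 2 * m)); last by ring.
by apply: mulr_ge0; [exact: mulr_ge0 (sqr_ge0 _)|lra].
Qed.

(** A substitute for the Hölder inequality [(E F^2)^3 <= (E |F|)^2 E F^4], with a free scale [m] to
    be taken of the typical size of [F]. *)
Lemma walk_norm_ge_moments t a (F : int * nat -> R) m : 0 <= m ->
  3 * m ^+ 2 * W t (fun b => F b ^+ 2) a - W t (fun b => F b ^+ 4) a <=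
  2 * m ^+ 3 * W t (fun b => `|F b|) a.
Proof.
move=> m0; rewrite -!walk_meanZ -mulN1r -walk_meanZ -walk_meanD.
by apply: walk_mean_le => b; rewrite mulN1r norm_ge_moments.
Qed.

Lemma tile_displacement_ge t k q : 48 <= q -> t%:R = q ^+ 4 -> 32 * k%:R <= q ^+ 2 ->
  q <= 4096 * W t (fun b => `|X b|) (0, k).
Proof.
move=> q48 tq kq; have [r rE] : exists r, r = q ^+ 2 by exists (q ^+ 2).
have tr : t%:R = r ^+ 2 by rewrite tq rE -exprM.
have r48 : 48 <= r by rewrite rE; nra.
rewrite -rE in kq.
have k0 : 0 <= k%:R :> R by exact: ler0n.
have k2 : 1024 * k%:R ^+ 2 <= r ^+ 2 by nra.
have EK : r <= 16 * W t K (0, k).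
  (* At this scale the left side is at least [12 r^4 - 4 r^4], and the right side is [128 r^3] times
     the mean of [K]. *)
  have := @walk_norm_ge_moments t (0, k) K (4 * r).
  have -> : W t (fun b => `|K b|) (0, k) = W t K (0, k).
    by apply: eq_walk_mean => b; rewrite ger0_norm // ler0n.
  have := tile_K2_ge t (0, k); have := tile_K4_le t (0, k).
  rewrite /= /K /= -/K tr => K4 K2 /(_ _) H.
  have r0 : 0 < r by lra.
  have k4 : k%:R ^+ 4 + 3 * k%:R ^+ 2 * r ^+ 2 <= r ^+ 4.
    move: k2; rewrite -[4%N]/(2 * 2)%N !exprM.
    have := sqr_ge0 (k%:R : R); have := sqr_ge0 r.
    by move: (k%:R ^+ 2) (r ^+ 2) => u v; nra.
  rewrite -(ler_pM2l (_ : 0 < 8 * r ^+ 3)); last by apply: mulr_gt0; [lra|exact: exprn_gt0].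
  have /le_trans /(_ K2) {}K2 : 4^-1 * r ^+ 2 <= k%:R ^+ 2 + 4^-1 * r ^+ 2.
    by rewrite lerDr sqr_ge0.
  have := ler_wpM2l (_ : 0 <= 48 * r ^+ 2) K2.
  rewrite mulr_ge0 ?sqr_ge0 // => /(_ isT).
  move/(_ ltac:(lra)): H; lra.
(* In [4 (E phi - phi)] the mean is at least [r / 16] and the initial value at most
   [r / 32 + 3 / 4]; [r >= 48] absorbs the 3/4. *)
have EX2 : r <= 16 * W t (fun b => X b ^+ 2) (0, k).
  have := tile_X2 t (0, k); rewrite [X (0, k)]/X /= expr0n subr0 => ->.
  have : W t K (0, k) <= W t phi (0, k).
    by apply: walk_mean_le => -[x [|j]]; rewrite /K /phi /=; lra.
  have : phi (0, k) <= k%:R + 3 / 4 by rewrite /phi /=; case: (k) => [|j]; lra.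
  by lra.
have EX4 : W t (fun b => X b ^+ 4) (0, k) <= 1728 * r ^+ 2.
  have := tile_X4_le t k; rewrite tr; nra.
(* At this scale the second moment contributes at least [6912 q^4], against at most [1728 q^4] for
   the fourth. *)
have := @walk_norm_ge_moments t (0, k) X (192 * q).
move=> /(_ ltac:(lra)) H.
have q0 : 0 < q by lra.
rewrite -(ler_pM2l (_ : 0 < 1728 * q ^+ 3)); last by apply: mulr_gt0; [lra|exact: exprn_gt0].
have := ler_wpM2l (_ : 0 <= 3 * (12 * q) ^+ 2) EX2.
rewrite mulr_ge0 ?sqr_ge0 // => /(_ isT).
have : 0 <= q ^+ 3 * W t (fun b => `|X b|) (0, k).
  apply: mulr_ge0; first by rewrite exprn_ge0 // ltW.
  by rewrite -(walk_mean_cst tile_next t 0 (0, k)); apply: walk_mean_le => b.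
move: H EX4; rewrite rE.
move: (W _ _ _) (W _ _ _) (W _ _ _) => u v w; lra.
Qed.
End tile_moments.

(** * The tiles of the mixer chain *)

Definition mixer_next (g : mixer_group) : 4.-tuple mixer_group :=
  map_tuple (fun u => (g * u)%g) (in_tuple Upsilon).

Definition swap_at (x y h : int) : int := x + transp_fun 0 y (- x + h).

Lemma mul_move (g : mixer_group) (e : int) :
  (g * Mixer e 1)%g = Mixer (mixer_pos g + e) (mixer_tiles g).
Proof.
case: g => x s; rewrite mixer_mulE; congr Mixer.
by apply: fspermP => h /=; rewrite /translation addNKr.
Qed.

Lemma mul_swap_pos (g : mixer_group) (e : int) :
  mixer_pos (g * Mixer 0 (fstransp 0 e))%g = mixer_pos g.
Proof. by case: g => x s; rewrite mixer_mulE /= addr0. Qed.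

Lemma mul_swap_tiles (g : mixer_group) (e z : int) :
  mixer_tiles (g * Mixer 0 (fstransp 0 e))%g z =
  swap_at (mixer_pos g) e (mixer_tiles g z).
Proof. by case: g. Qed.

Lemma swap_atE (x e p : int) : swap_at x e p =
  if p == x then x + e else if p == x + e then x else p.
Proof.
rewrite /swap_at /transp_fun.
by do ![case: eqVneq => //= ?]; lia.
Qed.

Section tile.
Variables (R : realType) (z : int).

(* Twice the martingale [p + sgz (x - p) / 2], where [p] is the position of the
   tile [z] and [x] the position of the mixer, recentred at its initial value. *)
Definition tile_coord (x p : int) : int := 2 * (p - z) + sgz (x - p) + sgz z.

Definition tile_pt (x p : int) : int * nat := (tile_coord x p, absz (x - p)).

Definition tile_state (g : mixer_group) : int * nat :=
  tile_pt (mixer_pos g) (mixer_tiles g z).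

(** The cases are the tile under the mixer, to its right, to its left, and out of reach of both
    swaps. The side of the tile permutes the successors, hence the statement with averages. *)
Lemma tile_state_lump (F : int * nat -> R) (g : mixer_group) :
  step_mean mixer_next (F \o tile_state) g = step_mean tile_next F (tile_state g).
Proof.
rewrite [LHS]/step_mean /= !big_cons big_nil /= /tile_state.
rewrite !mul_move !mul_swap_pos !mul_swap_tiles !swap_atE /=.
case: g => x s /=; set p := s z; clearbody p; clear s.
rewrite /tile_pt; set c := tile_coord x p.
have [k kE] : exists k, k = absz (x - p) by eexists.
have [xp|xp] := eqVneq p x.
  rewrite (_ : tile_coord (x + 1) p = c + 1); last by rewrite /c /tile_coord; lia.
  rewrite (_ : tile_coord (x + -1) p = c - 1); last by rewrite /c /tile_coord; lia.
  rewrite (_ : tile_coord x (x + 1) = c + 1); last by rewrite /c /tile_coord; lia.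
  rewrite (_ : tile_coord x (x + -1) = c - 1); last by rewrite /c /tile_coord; lia.
  rewrite (_ : absz (x + 1 - p)%R = 1%N); last lia.
  rewrite (_ : absz (x + -1 - p)%R = 1%N); last lia.
  rewrite (_ : absz (x - (x + 1))%R = 1%N); last lia.
  rewrite (_ : absz (x - (x + -1))%R = 1%N); last lia.
  rewrite (_ : absz (x - p)%R = 0%N); last lia.
  by rewrite tile_step_meanE /=; field.
have [xp1|xp1] := eqVneq p (x + 1).
  rewrite ifN; last lia.
  rewrite (_ : tile_coord (x + 1) p = c + 1); last by rewrite /c /tile_coord; lia.
  rewrite (_ : tile_coord (x + -1) p = c); last by rewrite /c /tile_coord; lia.
  rewrite (_ : tile_coord x x = c - 1); last by rewrite /c /tile_coord; lia.
  rewrite -/c.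
  rewrite (_ : absz (x + 1 - p)%R = 0%N); last lia.
  rewrite (_ : absz (x + -1 - p)%R = 2%N); last lia.
  rewrite (_ : absz (x - x)%R = 0%N); last lia.
  rewrite (_ : absz (x - p)%R = 1%N); last lia.
  by rewrite tile_step_meanE /=; field.
have [xp2|xp2] := eqVneq p (x + -1).
  rewrite (_ : tile_coord (x + 1) p = c); last by rewrite /c /tile_coord; lia.
  rewrite (_ : tile_coord (x + -1) p = c - 1); last by rewrite /c /tile_coord; lia.
  rewrite (_ : tile_coord x x = c + 1); last by rewrite /c /tile_coord; lia.
  rewrite -/c.
  rewrite (_ : absz (x + 1 - p)%R = 2%N); last lia.
  rewrite (_ : absz (x + -1 - p)%R = 0%N); last lia.
  rewrite (_ : absz (x - x)%R = 0%N); last lia.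
  rewrite (_ : absz (x - p)%R = 1%N); last lia.
  by rewrite tile_step_meanE /=; field.
rewrite (_ : tile_coord (x + 1) p = c); last by rewrite /c /tile_coord; lia.
rewrite (_ : tile_coord (x + -1) p = c); last by rewrite /c /tile_coord; lia.
rewrite -/c -kE tile_step_meanE.
have k2 : (1 < k)%N by lia.
case: k k2 kE => [|[|k]] // _ kE.
have [px|px] := leP p x.
  rewrite (_ : absz (x + 1 - p)%R = k.+3); last lia.
  rewrite (_ : absz (x + -1 - p)%R = k.+1); last lia.
  by field.
rewrite (_ : absz (x + 1 - p)%R = k.+1); last lia.
  rewrite (_ : absz (x + -1 - p)%R = k.+3); last lia.
by field.
Qed.
End tile.

(** * The word metric *)

Definition len (g : mixer_group) : nat := mixer_dist g 1%g.

(** [len g] is the length of a shortest word for [g^-1], that is, the least number of steps leading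
    from [g] to the identity. *)
Lemma lenP (g : mixer_group) k : (len g <= k)%N <->
  exists s : seq mixer_group,
    [/\ (size s <= k)%N, {subset s <= Upsilon} & (g * \prod_(u <- s) u = 1)%g].
Proof.
rewrite /len /mixer_dist; split.
  case: ex_minnP => m /asboolP[s [sm sU gs]] _ mk.
  by exists s; rewrite sm -gs mulg1 mulgV.
move=> [s [sk sU gs]]; case: ex_minnP => m _ mP; apply: leq_trans sk.
apply: mP; apply/asboolP; exists s; split => //.
by rewrite -[X in (_ * X)%g]gs mulKg.
Qed.

Lemma len1 : len 1%g = 0%N.
Proof.
by apply/eqP; rewrite -leqn0; apply/lenP; exists [::]; rewrite big_nil mulg1.
Qed.

Lemma len_mul_gen (g u : mixer_group) : u \in Upsilon ->
  (len g <= (len (g * u)%g).+1)%N.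
Proof.
move=> uU; have [/(_ (leqnn _))[s [sk sU gs]] _] := lenP (g * u)%g (len (g * u)%g).
apply/lenP; exists (u :: s); split; rewrite ?ltnS //; last by rewrite big_cons mulgA.
by move=> v; rewrite inE => /orP[/eqP ->//|/sU].
Qed.

(** Along a shortest way from [g] to the identity, [f] falls to 0 by at most [c] per step. *)
Lemma len_ge_potential (f : mixer_group -> nat) c : f 1%g = 0%N ->
  (forall g u, u \in Upsilon -> f g <= f (g * u)%g + c)%N ->
  forall g, (f g <= c * len g)%N.
Proof.
move=> f1 fc g; have [/(_ (leqnn _))[s [sk sU gs]] _] := lenP g (len g).
apply: leq_trans (_ : c * size s <= _)%N; last by rewrite leq_mul2l sk orbT.
elim: s sU g gs {sk} => [|u s IH] sU g.
  by rewrite big_nil mulg1 => ->; rewrite f1.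
rewrite big_cons mulgA => gs; rewrite mulnS addnC.
apply: leq_trans (fc g u _) _; first by apply: sU; rewrite mem_head.
by rewrite leq_add2r; apply: IH => // v vs; apply: sU; rewrite inE vs orbT.
Qed.

Lemma Upsilon_ind (P : mixer_group -> Prop) :
  P (Mixer 1 1%g) -> P (Mixer (-1) 1%g) ->
  P (Mixer 0 (fstransp 0 1)) -> P (Mixer 0 (fstransp 0 (-1))) ->
  forall u, u \in Upsilon -> P u.
Proof. by move=> P1 P2 P3 P4 u; rewrite !inE => /or4P[] /eqP ->. Qed.

Lemma pos_le_len (g : mixer_group) : (absz (mixer_pos g) <= len g)%N.
Proof.
rewrite -[leqRHS]mul1n; move: g.
apply: (len_ge_potential (f := fun g => absz (mixer_pos g))) => // g.
by apply: Upsilon_ind; rewrite ?mul_move ?mul_swap_pos /=; lia.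
Qed.

Lemma fsperm_inj (s : fsperm) : injective s.
Proof. exact: bij_inj (fsperm_bij s). Qed.

Lemma sum_fsperm_eq (s : fsperm) (Z : seq int) (y : int) : uniq Z ->
  (\sum_(z <- Z) (s z == y) <= 1)%N.
Proof.
move=> uZ; have -> : (\sum_(z <- Z) (s z == y) = count_mem y (map s Z))%N.
  rewrite count_map -sum1_count [RHS]big_mkcond.
  by apply: eq_bigr => z _ /=; case: eqP.
by rewrite count_uniq_mem ?leq_b1 // map_inj_uniq //; exact: fsperm_inj.
Qed.

Lemma displacement_le_len (Z : seq int) (g : mixer_group) : uniq Z ->
  (\sum_(z <- Z) absz (mixer_tiles g z - z)%R <= 2 * len g)%N.
Proof.
move=> uZ; move: g.
apply: (len_ge_potential (f := fun g => (\sum_(z <- Z) absz (mixer_tiles g z - z)%R)%N)).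
  by rewrite big1 // => z _; rewrite /= subrr.
move=> g; have swap e : e \in [:: 1; -1] ->
    (\sum_(z <- Z) absz (mixer_tiles g z - z)%R <= \sum_(z <- Z)
    absz (mixer_tiles (g * Mixer 0 (fstransp 0 e))%g z - z)%R + 2)%N.
  move=> e1; apply: (@leq_trans (\sum_(z <- Z)
      (absz (mixer_tiles (g * Mixer 0 (fstransp 0 e))%g z - z)%R
      + ((mixer_tiles g z == mixer_pos g) + (mixer_tiles g z == mixer_pos g + e)%R)))).
    apply: leq_sum => z _; rewrite mul_swap_tiles swap_atE.
    by move: e1; rewrite !inE; do ![case: eqVneq => //= ?]; lia.
  by rewrite !big_split leq_add2l (leq_add (sum_fsperm_eq _ _ uZ) (sum_fsperm_eq _ _ uZ)).
apply: Upsilon_ind; rewrite ?mul_move ?leq_addr //=; apply: swap; rewrite !inE eqxx ?orbT //.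
Qed.

Lemma len_move (x y : int) (s : fsperm) :
  (len (Mixer x s) <= len (Mixer y s) + absz (x - y)%R)%N.
Proof.
have [n] := ubnP (absz (x - y)%R); elim: n => // n IH in x *.
move=> xn; have [->|xy] := eqVneq x y; first by rewrite subrr addn0.
pose e : int := if x < y then 1 else -1.
have eU : Mixer e 1%g \in Upsilon.
  by rewrite /e; case: ifP => _; rewrite !inE eqxx ?orbT.
have := len_mul_gen (Mixer x s) eU; rewrite mul_move /= => /leq_trans -> //.
have := IH (x + e); rewrite /e; case: ltP => xy' /(_ ltac:(lia)); lia.
Qed.

(** The mixer carries the tile at [x] to the right by [m] swaps, each followed by a move; every tile
    passed shifts left by one. *)
Lemma len_carry (m : nat) (x : int) (s : fsperm) : exists2 s' : fsperm,
  (forall z, s' z = if s z == x then x + m%:Z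
                    else if x < s z <= x + m%:Z then s z - 1 else s z) &
  (len (Mixer x s) <= len (Mixer (x + m%:Z) s') + 2 * m)%N.
Proof.
elim: m => [|m [s' s'E len']].
  exists s; last by rewrite addr0 muln0 addn0.
  by move=> z; rewrite addr0; case: eqVneq => [//|_]; rewrite ifN //; lia.
set g := (Mixer (x + m%:Z) s' * Mixer 0 (fstransp 0 1))%g.
have gU : Mixer 0 (fstransp 0 1) \in Upsilon by rewrite !inE eqxx !orbT.
exists (mixer_tiles g) => [z|].
  rewrite mul_swap_tiles swap_atE /= s'E.
  have [//|sx] := eqVneq (s z) x; first by rewrite eqxx; lia.
  have [b|b] := boolP (x < s z <= x + m%:Z).
    rewrite [RHS]ifT; last lia.
    by rewrite ifN; last lia; rewrite ifN //; lia.
  have [c|c] := eqVneq (s z) (x + m%:Z + 1); first by rewrite ifN ?ifT; lia.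
  by rewrite !ifN //; lia.
have := len_mul_gen (Mixer (x + m%:Z) s') gU; rewrite -/g.
have gE : g = Mixer (x + m%:Z) (mixer_tiles g).
  by rewrite {1}/g mixer_mulE addr0.
have := len_move (x + m%:Z) (x + m.+1%:Z) (mixer_tiles g); rewrite -gE.
lia.
Qed.

Lemma sum_in_interval (h : nat -> int) (n : nat) (lo hi : int) : injective h ->
  (\sum_(0 <= j < n) (lo < h j <= hi)%R <= absz (Num.max 0 (hi - lo))%R)%N.
Proof.
move=> hi_inj; set m := absz _.
have -> : (\sum_(0 <= j < n) (lo < h j <= hi)%R =
    size [seq h j | j <- index_iota 0 n & (lo < h j <= hi)%R])%N.
  rewrite size_map size_filter -sum1_count [RHS]big_mkcond.
  by apply: eq_bigr => j _; case: andP.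
have <- : size [seq lo + 1 + k%:Z | k <- iota 0 m] = m by rewrite size_map size_iota.
apply: uniq_leq_size.
  by rewrite map_inj_uniq // filter_uniq ?iota_uniq.
move=> y /mapP[j]; rewrite mem_filter => /andP[jP _] ->.
by apply/mapP; exists (absz (h j - lo - 1)%R); rewrite ?mem_iota /m; lia.
Qed.

Definition inversions (a : int) (s : fsperm) (n : nat) : nat :=
  \sum_(0 <= i < n) \sum_(0 <= j < i) (s (a + i%:Z) < s (a + j%:Z))%R.

(* An inversion [j < i], [s i < s j] has [j < i <= s j] or [s i < s j < i]; the
   former number at most [s j - j] for given [j], the latter [i - s i] for
   given [i]. *)
Lemma inversions_le (a : int) (s : fsperm) (n : nat) :
  (inversions a s n <= \sum_(0 <= i < n) absz (s (a + i%:Z) - (a + i%:Z))%R)%N.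
Proof.
pose f (i : nat) := s (a + i%:Z) - a.
have f_inj : injective f by move=> i j /addIr /fsperm_inj /addrI [].
have Posz_inj : injective Posz by move=> i j [].
apply: (@leq_trans (\sum_(0 <= i < n) \sum_(0 <= j < n) (j%:Z < i%:Z <= f j)%R +
    \sum_(0 <= i < n) \sum_(0 <= j < n) (f i < f j <= i%:Z)%R)).
  rewrite /inversions -big_split big_nat [leqRHS]big_nat.
  apply: leq_sum => i /andP[_ ilt].
  rewrite -big_split /= (big_cat_nat (n := i) (p := n)) ?(ltnW ilt) //=.
  apply: (leq_trans _ (leq_addr _ _)); rewrite big_nat [leqRHS]big_nat.
  apply: leq_sum => j /andP[_ jlt].
  by rewrite /f; case: ltP => //= ?; case: andP => //= ?; case: andP => //= ?; lia.
rewrite exchange_big -big_split /=; apply: leq_sum => i _.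
apply: leq_trans (leq_add (sum_in_interval _ _ _ Posz_inj) (sum_in_interval _ _ _ f_inj)) _.
by rewrite /f; lia.
Qed.

(** Insertion sort from the right end: the mixer walks to the tile of the last site, [m + 1] moves,
    and carries it home in [2 m] steps, ending one site to the left of its start. The [3 m] is paid
    by the inversions of that tile. *)
Lemma len_le_inversions (a : int) (n : nat) (s : fsperm) :
  (forall z : int, ~~ (a <= z < a + n%:Z) -> s z = z) ->
  (len (Mixer (a + n%:Z) s) <= absz a + n + 3 * inversions a s n)%N.
Proof.
elim: n s => [|n IH] s sfix.
  have -> : s = 1%g by apply: fspermP => z; apply: sfix; lia.
  rewrite addr0; have := len_move a 0 1%g.
  by rewrite (_ : Mixer 0 1%g = 1%g) // len1 subr0; lia.
have si := @fsperm_inj s.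
set w := a + n%:Z.
have sw : a <= s w <= w.
  apply: contraT => H; have /si E : s (s w) = s w by apply: sfix; lia.
  by move: H; rewrite E; lia.
have [m mE] : exists m : nat, s w = w - m%:Z by exists (absz (w - s w)%R); lia.
have [s' s'E len'] := len_carry m (s w) s.
have s'fix z : ~~ (a <= z < a + n%:Z) -> s' z = z.
  move=> zn; rewrite s'E; have [/si ->|zw] := eqVneq (s z) (s w).
    by rewrite mE subrK.
  have zw' : z != w by apply: contra_neq zw => ->.
  by rewrite (sfix z) ?ifN //; lia.
(* Carrying one tile preserves the relative order of all the others. *)
have inv' : inversions a s' n = inversions a s n.
  apply: eq_big_nat => i /andP[_ iltn]; apply: eq_big_nat => j /andP[_ jlti].
  rewrite !s'E.
  have iw : s (a + i%:Z) != s w by apply/negP => /eqP/si; lia.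
  have jw : s (a + j%:Z) != s w by apply/negP => /eqP/si; lia.
  have ij : s (a + i%:Z) != s (a + j%:Z) by apply/negP => /eqP/si; lia.
  rewrite (negbTE iw) (negbTE jw); congr (nat_of_bool _).
  by do 2!case: ifPn => ?; lia.
(* The [m] sites after [s w], up to [w], hold tiles of the window that are smaller than [w]: each
   forms an inversion with [w]. *)
have invw : (m <= \sum_(0 <= j < n) (s w < s (a + j%:Z))%R)%N.
  have -> : (\sum_(0 <= j < n) (s w < s (a + j%:Z))%R =
      size [seq s (a + j%:Z)%R | j <- index_iota 0 n & (s w < s (a + j%:Z))%R])%N.
    rewrite size_map size_filter -sum1_count [RHS]big_mkcond.
    by apply: eq_bigr => j _; case: ltP.
  have <- : size [seq (s w + 1 + k%:Z)%R | k <- iota 0 m] = m by rewrite size_map size_iota.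
  apply: uniq_leq_size.
    by rewrite map_inj_uniq ?iota_uniq // => i j /addrI [].
  move=> y /mapP[k]; rewrite mem_iota => km ->.
  set y' := s w + 1 + k%:Z.
  pose z := fsperm_inv s y'; have zE : s z = y' by exact: fsperm_invVK.
  have zin : a <= z < a + n.+1%:Z.
    apply: contraT => /[dup] zn /sfix; rewrite zE /y' => zy; lia.
  have zw : z != w by apply/negP => /eqP zw; move: zE; rewrite zw /y'; lia.
  apply/mapP; exists (absz (z - a)%R); last by rewrite -zE; congr (s _); lia.
  have za : a + (absz (z - a)%R)%:Z = z by lia.
  by rewrite mem_filter za zE mem_index_iota /y'; lia.
have := IH s' s'fix; rewrite inv' /inversions big_nat_recr //= -/(inversions a s n).
have := len_move (a + n.+1%:Z) (s w) s.
rewrite (_ : s w + m%:Z = w) in len'; last lia.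
by rewrite -/w; lia.
Qed.

(** The window runs from [- (M + 1)] to [M + 1]. Walking to [M + 2], where the sorting starts, costs
    at most [2 M + 2], and the terms [absz a + n] of the sorting make [3 M + 4]. *)
Lemma len_le (M : nat) (x : int) (s : fsperm) :
  (absz x <= M)%N -> (forall z : int, (M.+1 < absz z)%N -> s z = z) ->
  (len (Mixer x s) <= 6 * M.+1 +
    3 * \sum_(0 <= i < M.*2.+3)
          absz (s (- M.+1%:Z + i%:Z) - (- M.+1%:Z + i%:Z))%R)%N.
Proof.
move=> xM sM; pose n := M.*2.+3.
have := @len_le_inversions (- M.+1%:Z) n s.
move=> /(_ (fun z zn => sM z ltac:(lia))).
have := inversions_le (- M.+1%:Z) s n.
have := len_move x (- M.+1%:Z + n%:Z) s; rewrite /n.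
move: (inversions _ _ _) (\sum_(_ <= _ < _) _)%N (len _) (len _) => I D l1 l2; lia.
Qed.

(** * Expectations as averages over words *)

(** The generators are told apart by their position and the image of 1. Their distinctness makes the
    words below pairwise distinct. *)
Lemma Upsilon_uniq : uniq Upsilon.
Proof.
by apply: (@map_uniq _ _ (fun g => (mixer_pos g, mixer_tiles g 1))).
Qed.

Fixpoint words (t : nat) : seq (seq mixer_group) :=
  if t is t'.+1 then [seq rcons v u | v <- words t', u <- Upsilon] else [:: [::]].

Lemma size_words t v : v \in words t -> size v = t.
Proof.
elim: t v => [|t IH] v; first by rewrite inE => /eqP ->.
by move=> /allpairsP[[v' u] /= [/IH v't _ ->]]; rewrite size_rcons v't.
Qed.

Lemma words_sub t v : v \in words t -> {subset v <= Upsilon}.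
Proof.
elim: t v => [|t IH] v; first by rewrite inE => /eqP ->.
move=> /allpairsP[[v' u] /= [/IH v't uU ->]] x; rewrite mem_rcons inE.
by move=> /orP[/eqP ->|/v't].
Qed.

Lemma words_uniq t : uniq (words t).
Proof.
elim: t => // t IH; apply: allpairs_uniq => //; first exact: Upsilon_uniq.
by move=> [v u] [v' u'] _ _ /= /rcons_inj [-> ->].
Qed.

Lemma walk_mean_words (R : realFieldType) t (f : mixer_group -> R) :
  walk_mean mixer_next t f 1%g =
  \sum_(v <- words t) (4^-1) ^+ t * f (\prod_(u <- v) u)%g.
Proof.
elim: t f => [|t IH] f; first by rewrite /= big_seq1 big_nil expr0 mul1r.
rewrite walk_meanSr IH [words _]/= big_allpairs_dep; apply: eq_bigr => v _.
rewrite /step_mean big_map /= mulrA mulr_sumr -exprSr.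
by apply: eq_bigr => u _; rewrite big_rcons.
Qed.

(** Every element is a product over a finite sequence of indices into [Upsilon]. *)
Lemma mixer_group_countable : countable [set: mixer_group].
Proof.
pose f (s : seq nat) := (\prod_(i <- s) nth 1%g Upsilon i)%g.
apply: (@sub_countable _ _ _ [set: seq nat]); last exact: countableP.
apply: card_le_trans (card_image_le f _); apply: subset_card_le => g _.
have [k /asboolP[s [_ sU ->]]] := generated g.
exists (map (fun u => index u Upsilon) s) => //.
rewrite /f big_map big_seq [RHS]big_seq; apply: eq_bigr => u us.
by rewrite nth_index //; exact: sU.
Qed.

Section chain.
Context d (T : measurableType d) (R : realType) (P : probability T R).
Variables (upsilon : nat -> {RV P >-> mixer_group}) (omega : nat -> T -> mixer_group).
Hypotheses (indep : mutually_independent upsilon)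
  (unif : forall t, uniform_on_Upsilon (upsilon t))
  (omega0 : forall w, omega 0%N w = 1%g)
  (omegaS : forall t w, omega t.+1 w = (omega t w * upsilon t w)%g).

(** The event splits over the countably many values of [omega t]. *)
Lemma measurable_omega t (A : set mixer_group) : measurable (omega t @^-1` A).
Proof.
elim: t A => [|t IH] A.
  have [A1|A1] := pselect (A 1%g).
    rewrite (_ : _ @^-1` _ = setT) //; apply/seteqP; split => // w _ /=.
    by rewrite omega0.
  rewrite (_ : _ @^-1` _ = set0) //; apply/seteqP; split => // w /=.
  by rewrite omega0.
rewrite (_ : _ @^-1` _ = \bigcup_g (omega t @^-1` [set g] `&`
    upsilon t @^-1` [set u | A (g * u)%g])).
  apply: countable_bigcupT_measurable => [|g]; first exact: mixer_group_countable.
  apply: measurableI; first exact: IH.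
  rewrite -[X in measurable X]setTI; exact: measurable_funPT.
apply/seteqP; split => w /=; rewrite omegaS.
  by move=> Aw; exists (omega t w).
by move=> [g _ [-> ]].
Qed.

Definition cylinder (v : seq mixer_group) : set T :=
  [set w | forall j, (j < size v)%N -> upsilon j w = nth 1%g v j].

Lemma cylinderE v : cylinder v =
  \bigcap_(j in [set` [fset x | x in iota 0 (size v)]%fset])
    upsilon j @^-1` [set nth 1%g v j].
Proof.
apply/seteqP; split => w H j.
  by rewrite /= !inE /= mem_iota => jv; exact: H.
by move=> jv; apply: H; rewrite /= !inE /= mem_iota.
Qed.

Lemma measurable_cylinder v : measurable (cylinder v).
Proof.
rewrite cylinderE; apply: bigcap_measurableType => j _.
by rewrite -[X in measurable X]setTI; exact: measurable_funPT.
Qed.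

Lemma P_cylinder v : {subset v <= Upsilon} ->
  P (cylinder v) = ((4^-1) ^+ size v)%:E.
Proof.
move=> vU; rewrite cylinderE.
rewrite (@indep _ (fun j => [set nth 1%g v j])) //.
rewrite (eq_big_seq (fun=> (4^-1)%:E)); last first.
  move=> j; rewrite !inE mem_iota => jv.
  by apply: unif; apply: vU; rewrite mem_nth.
rewrite big_const_seq count_predT.
rewrite (_ : size _ = size v); last by rewrite card_fseq undup_id ?iota_uniq ?size_iota.
by elim: (size v) => [|n IH] //=; rewrite IH -EFinM exprS.
Qed.

Lemma omega_cylinder v w : cylinder v w -> omega (size v) w = (\prod_(u <- v) u)%g.
Proof.
elim/last_ind: v => [|v u IH]; first by rewrite big_nil omega0.
rewrite size_rcons omegaS => vw; rewrite big_rcons IH; last first.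
  by move=> j jv; rewrite vw ?size_rcons ?ltnS ?(ltnW jv) // nth_rcons jv.
by rewrite (vw (size v)) ?size_rcons // nth_rcons ltnn eqxx.
Qed.

(** The steps lie in [Upsilon] only almost surely. The cylinders over words of length [t] are
    disjoint, [omega t] is constant on each, and the case of the function 1 shows that their union
    has probability 1. *)
Lemma expectation_omega t (f : mixer_group -> R) : (forall g, 0 <= f g) ->
  ('E_P[fun w => f (omega t w)] = (walk_mean mixer_next t f 1%g)%:E)%E.
Proof.
move=> f0; pose D := \big[setU/set0]_(v <- words t) cylinder v.
have mD : measurable D by apply: bigsetU_measurable => v _; exact: measurable_cylinder.
have tD : trivIset [set` words t] cylinder.
  move=> v v' /= vt v't [w [vw v'w]].
  apply: (@eq_from_nth _ 1%g); first by rewrite (size_words vt) (size_words v't).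
  move=> j jv; rewrite -vw // v'w // (size_words v't) -(size_words vt) //.
have intD (g : mixer_group -> R) : (forall h, 0 <= g h) ->
    measurable_fun [set: T] (g \o omega t) ->
    (\int[P]_(w in D) (g (omega t w))%:E)%E = (walk_mean mixer_next t g 1%g)%:E.
  move=> g0 mg; rewrite ge0_integral_bigsetU ?words_uniq //; last 3 first.
  - exact: measurable_cylinder.
  - by apply/measurable_EFinP; exact: measurable_funTS.
  - by move=> w _; rewrite lee_fin.
  rewrite walk_mean_words -sumEFin.
  rewrite big_seq [RHS]big_seq; apply: eq_bigr => v vt.
  rewrite (eq_integral (cst (g (\prod_(u <- v) u)%g)%:E)); last first.
    by move=> w; rewrite inE => /omega_cylinder; rewrite (size_words vt) /= => ->.
  rewrite integral_cst; last exact: measurable_cylinder.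
  rewrite [X in (_ * X)%E](P_cylinder (words_sub vt)) (size_words vt).
  by rewrite -EFinM mulrC.
have PD : P D = 1%E.
  have := intD (fun=> 1) (fun=> ler01) (measurable_cst _).
  by rewrite integral_cst // mul1e walk_mean_cst.
have mf : measurable_fun [set: T] (f \o omega t).
  move=> _ B mB; rewrite setTI.
  exact: (@measurable_omega t (f @^-1` B)).
rewrite unlock -(intD f f0 mf).
rewrite (@ge0_negligible_integral _ _ _ _ _ (~` D)) //; first last.
- by have := probability_setC P mD; rewrite PD subee.
- by move=> w _; rewrite lee_fin.
- exact/measurable_EFinP.
- exact: measurableC.
- by rewrite setDE setTI setCK.
Qed.
End chain.

(** * The two bounds *)

Section bounds.
Variable R : realType.
Local Notation W := (@walk_mean R mixer_group mixer_next).
Local Notation L := (@step_mean R mixer_group mixer_next).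

Lemma mixer_step_meanE (F : mixer_group -> R) g : L F g =
  4^-1 * (F (Mixer (mixer_pos g + 1) (mixer_tiles g)) +
          F (Mixer (mixer_pos g - 1) (mixer_tiles g)) +
          F (g * Mixer 0 (fstransp 0 1))%g +
          F (g * Mixer 0 (fstransp 0 (-1)))%g).
Proof. by rewrite /step_mean /= !big_cons big_nil !mul_move addr0 !addrA. Qed.

Lemma walk_pos2 t : W t (fun g => (mixer_pos g)%:~R ^+ 2) 1%g = t%:R / 2.
Proof.
have D g : L (fun g => (mixer_pos g)%:~R ^+ 2) g = (mixer_pos g)%:~R ^+ 2 + 2^-1.
  by rewrite mixer_step_meanE !mul_swap_pos /= rmorphD rmorphB /=; field.
apply/eqP; rewrite eq_le; apply/andP; split.
  have := @walk_mean_drift_le R _ mixer_next (fun g => (mixer_pos g)%:~R ^+ 2) 2^-1 1%g t.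
  by rewrite /= mulr0z expr0n add0r (mulrC 2^-1); apply => g; rewrite D.
have := @walk_mean_drift_ge R _ mixer_next (fun g => (mixer_pos g)%:~R ^+ 2) 2^-1 1%g t.
by rewrite /= mulr0z expr0n add0r (mulrC 2^-1); apply => g; rewrite D.
Qed.

Lemma mixer_next_ind g (Q : mixer_group -> Prop) :
  Q (Mixer (mixer_pos g + 1) (mixer_tiles g)) ->
  Q (Mixer (mixer_pos g - 1) (mixer_tiles g)) ->
  Q (g * Mixer 0 (fstransp 0 1))%g -> Q (g * Mixer 0 (fstransp 0 (-1)))%g ->
  forall h, h \in mixer_next g -> Q h.
Proof.
move=> Q1 Q2 Q3 Q4 h /mapP[u uU ->]; move: u uU.
by apply: Upsilon_ind; rewrite ?mul_move.
Qed.

(** At time [t.+1] the position [x] satisfies [x^2 <= t.+1 |x| <= t.+1 len], while the mean of [x^2]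
    is [t.+1 / 2]. This serves for small times. *)
Lemma walk_len_ge_half t : 2^-1 <= W t.+1 (fun g => (len g)%:R) 1%g.
Proof.
have : W t.+1 (fun g => (mixer_pos g)%:~R ^+ 2) 1%g <=
    W t.+1 (fun g => t.+1%:R * (len g)%:R) 1%g.
  apply: (@walk_mean_le_in _ _ _ (fun t g => absz (mixer_pos g) <= t)%N) => //.
    move=> s g h gs; move: h.
    by apply: mixer_next_ind; rewrite ?mul_swap_pos /=; lia.
  move=> g gt; rewrite -natrM -rmorphXn -[leRHS]mulrz_nat ler_int.
  have := pos_le_len g; move: gt; set x := mixer_pos g; set l := len g; nia.
rewrite walk_pos2 walk_meanZ ler_pM2l //.
Qed.

Lemma tile_state1 z : tile_state z 1%g = (0, absz z).
Proof. by rewrite /tile_state /tile_pt /tile_coord /=; congr pair; lia. Qed.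

Lemma walk_tile t (F : int * nat -> R) z :
  W t (fun g => F (tile_state z g)) 1%g = walk_mean tile_next t F (0, absz z).
Proof. by rewrite -tile_state1 -(walk_mean_lump (tile_state_lump _)). Qed.

Let X z g : R := (tile_state z g).1%:~R.

Lemma displacement_tile_state z g :
  (`|X z g| <= 2 * (absz (mixer_tiles g z - z)%R)%:R + 2) /\
  (2 * (absz (mixer_tiles g z - z)%R)%:R <= `|X z g| + 2).
Proof.
rewrite /X /= /tile_coord -intr_norm -natr_absz -!natrM -!natrD !ler_nat.
lia.
Qed.

(** Passing from [|X|] to the displacement costs an additive [2 * 4096], at most half of [q]. *)
Lemma walk_displacement_ge t z (q : R) : 64 * 256 <= q -> t%:R = q ^+ 4 ->
  32 * (absz z)%:R <= q ^+ 2 ->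
  q <= 64 * 256 * W t (fun g => (absz (mixer_tiles g z - z)%R)%:R) 1%g.
Proof.
move=> qN tq zq; have := @tile_displacement_ge R t (absz z) q.
move=> /(_ ltac:(lra) tq zq).
rewrite -(walk_tile t (fun b => `|b.1%:~R|)).
have : W t (fun g => `|(tile_state z g).1%:~R|) 1%g <=
    W t (fun g => 2 * (absz (mixer_tiles g z - z)%R)%:R + 2) 1%g.
  by apply: walk_mean_le => g; have [] := displacement_tile_state z g.
rewrite walk_meanD walk_meanZ walk_mean_cst; lra.
Qed.

(** The tiles from 0 to [n] are more than [q^2 / 32] in number, all close enough to the origin for
    [walk_displacement_ge]. *)
Lemma walk_len_ge t (q : R) : 64 * 256 <= q -> t%:R = q ^+ 4 ->
  q ^+ 3 <= 64 * (64 * 256) * W t (fun g => (len g)%:R) 1%g.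
Proof.
move=> qN tq; pose n := Num.trunc (q ^+ 2 / 32).
have q0 : 0 <= q by lra.
have q2 : 0 <= q ^+ 2 / 32 by rewrite divr_ge0 ?sqr_ge0.
have /andP[nq qn] := truncn_itv q2; rewrite -/n in nq qn.
pose Z := [seq i%:Z | i <- iota 0 n.+1].
have uZ : uniq Z by rewrite map_inj_uniq ?iota_uniq // => i j [].
have : W t (fun g => \sum_(z <- Z) (absz (mixer_tiles g z - z)%R)%:R) 1%g <=
    W t (fun g => 2 * (len g)%:R) 1%g.
  apply: walk_mean_le => g; rewrite -natrM -natr_sum ler_nat.
  exact: displacement_le_len.
rewrite walk_meanZ walk_mean_sum.
have : \sum_(z <- Z) q <=  64 * 256 *
    \sum_(z <- Z) W t (fun g => (absz (mixer_tiles g z - z)%R)%:R) 1%g.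
  rewrite mulr_sumr big_seq [leRHS]big_seq; apply: ler_sum => z /mapP[i].
  rewrite mem_iota => /andP[_ it] ->; apply: walk_displacement_ge => //=.
  have : i%:R <= n%:R :> R by rewrite ler_nat.
  by lra.
rewrite big_const_seq count_predT size_map size_iota iter_addr_0 -(mulr_natl q).
have : q ^+ 2 / 32 * q <= n.+1%:R * q by rewrite ler_wpM2r // ltW.
set A := n.+1%:R * q; move: (\sum_(_ <- _) _) (W _ _ _) => B C.
by rewrite [q ^+ 3]exprSr; lra.
Qed.

Lemma walk_tile_coord2 t (Z : seq int) : uniq Z ->
  W t (fun g => \sum_(z <- Z) X z g ^+ 2) 1%g <= 2 * t%:R.
Proof.
move=> uZ.
have := @walk_mean_drift_le R _ mixer_next
  (fun g => \sum_(z <- Z) X z g ^+ 2) 2 1%g t.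
rewrite /= [X in X + _]big1 ?add0r; last first.
  by move=> z _; rewrite /X tile_state1 expr0n.
apply=> g; have := @walk_mean_sum R _ mixer_next _ Z 1 (fun z g => X z g ^+ 2) g.
rewrite /walk_mean /= => ->.
(* Offsets from the mixer with the drift of [X^2] for a tile there; each site holds at most one
   tile, so the drifts add up to at most 2. *)
pose c := [:: (0 : int, 1 : R); (1, 2^-1); (-1, 2^-1)].
have -> : 2 = \sum_(i <- c) i.2 :> R.
  by rewrite !big_cons big_nil /=; field.
have step z : L (fun g => X z g ^+ 2) g <= X z g ^+ 2 +
    \sum_(i <- c) i.2 * (mixer_tiles g z == mixer_pos g + i.1)%:R.
  rewrite (tile_state_lump z (fun b => b.1%:~R ^+ 2) g).
  rewrite /X /tile_state /tile_pt /= tile_step_meanE.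
  move: (mixer_tiles g z) (mixer_pos g) => p x.
  rewrite !big_cons big_nil /= !addr0; move: (tile_coord z x p) => y.
  have [k kE] : exists k, k = absz (x - p) by eexists.
  rewrite -kE; case: k kE => [|[|k]] kE; rewrite ?(rmorphD, rmorphN, rmorph1) /=.
  - rewrite (_ : p == x) ?mulr1n; last lia.
    have := ler0n R (p == x + 1); have := ler0n R (p == x + -1); lra.
  - have [xp|xp] := eqVneq p (x + 1); rewrite ?mulr1n ?mulr0n.
      have := ler0n R (p == x); have := ler0n R (p == x + -1); lra.
    rewrite (_ : p == x + -1) ?mulr1n; last lia.
    have := ler0n R (p == x); lra.
  - have := ler0n R (p == x); have := ler0n R (p == x + 1).
    have := ler0n R (p == x + -1); lra.
apply: le_trans (ler_sum _ (fun z _ => step z)) _.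
rewrite big_split lerD2l exchange_big big_seq [leRHS]big_seq.
apply: ler_sum => -[e a] ac /=; rewrite -mulr_sumr -natr_sum ler_piMr //.
  by move: ac; rewrite !inE => /or3P[] /eqP[_ ->].
by rewrite (ler_nat R _ 1) sum_fsperm_eq.
Qed.

Lemma ler_sum_uniq (T : eqType) (F : T -> R) (s1 s2 : seq T) :
  uniq s1 -> uniq s2 -> (forall z, 0 <= F z) -> {subset s1 <= s2} ->
  \sum_(z <- s1) F z <= \sum_(z <- s2) F z.
Proof.
move=> u1 u2 F0 s12; have p : perm_eq s1 [seq z <- s2 | z \in s1].
  apply: uniq_perm; rewrite ?filter_uniq // => z; rewrite mem_filter /=.
  by case zs1: (z \in s1) => //=; rewrite s12.
by rewrite (perm_big _ p) big_filter big_mkcond; apply: ler_sum => z _; case: ifP.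
Qed.

(** * The running maximum of the mixer's distance from 0, and the upper bound *)

Section maximum.

Definition max_next (a : mixer_group * nat) : 4.-tuple (mixer_group * nat) :=
  map_tuple (fun g => (g, maxn a.2 (absz (mixer_pos g)))) (mixer_next a.1).

Local Notation V := (@walk_mean R (mixer_group * nat)%type max_next).

Lemma step_mean_max (F : mixer_group * nat -> R) g m :
  step_mean max_next F (g, m) = L (fun h => F (h, maxn m (absz (mixer_pos h)))) g.
Proof. by rewrite /step_mean /= !big_cons !big_nil. Qed.

Lemma max_next_lump t (F : mixer_group -> R) a :
  V t (F \o fst) a = W t F a.1.
Proof.
by apply: walk_mean_lump => {F}F [g m]; rewrite step_mean_max.
Qed.

(** A swap reaches one site past the mixer, hence [a.2.+1]. The bound by [t] provides a window that
    does not depend on the path. *)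
Definition max_inv (t : nat) (a : mixer_group * nat) : Prop :=
  [/\ (absz (mixer_pos a.1) <= a.2)%N, (a.2 <= t)%N &
      forall z : int, (a.2.+1 < absz z)%N -> mixer_tiles a.1 z = z].

Lemma max_inv_next s a b : max_inv s a -> b \in max_next a -> max_inv s.+1 b.
Proof.
case: a => g m [/= gm ms fixg] /mapP[h hg ->] /=; move: h hg.
apply: mixer_next_ind; split; rewrite ?mul_swap_pos /=; try lia.
- by move=> z zm; apply: fixg; lia.
- by move=> z zm; apply: fixg; lia.
- move=> z zm; rewrite [LHS](mul_swap_tiles g 1 z) swap_atE fixg ?ifN; lia.
- move=> z zm; rewrite [LHS](mul_swap_tiles g (-1) z) swap_atE fixg ?ifN; lia.
Qed.

(** While the maximum [m] is kept, [G] is affine in [|y|], which has nonnegative drift; a new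
    maximum [m + 1] only adds 1 to [2 m |y| - m^2]. *)
Lemma max_submartingale (x : int) (m : nat) : (absz x <= m)%N ->
  let G (y : int) := let m' := maxn m (absz y) in
    2 * m'%:Z * (absz y)%:Z - m'%:Z ^+ 2 in
  2 * G x <= G (x + 1) + G (x - 1).
Proof.
move=> xm /=; have [->|x0] := eqVneq x 0.
  by rewrite add0r sub0r /=; case: m {xm} => [|m] //; rewrite maxn0 (maxn_idPl _) //; nia.
have step a : (0 < a <= m)%N ->
    2 * (2 * m%:Z * a%:Z - m%:Z ^+ 2) <=
    2 * (maxn m a.+1)%:Z * a.+1%:Z - (maxn m a.+1)%:Z ^+ 2 +
    (2 * m%:Z * a.-1%:Z - m%:Z ^+ 2).
  move=> /andP[a0 am]; rewrite /maxn; case: ltnP => ma; nia.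
rewrite (maxn_idPl xm); have := step (absz x) ltac:(lia).
have mx : maxn m (absz x).-1 = m by lia.
have [xp|xn] := ltP 0 x.
  rewrite (_ : absz (x + 1)%R = (absz x).+1); last lia.
  rewrite (_ : absz (x - 1)%R = (absz x).-1); last lia.
  by rewrite mx.
rewrite (_ : absz (x + 1)%R = (absz x).-1); last lia.
rewrite (_ : absz (x - 1)%R = (absz x).+1); last lia.
by move=> H; rewrite mx [leRHS]addrC.
Qed.

(** Doob's maximal inequality in mean square: [0 <= E (2 M |x| - M^2)] and
    [2 M |x| <= 2 x^2 + M^2 / 2] give [E M^2 <= 4 E x^2]. *)
Lemma walk_max2 t : V t (fun a => a.2%:R ^+ 2) (1%g, 0%N) <= 2 * t%:R.
Proof.
pose G (a : mixer_group * nat) : R :=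
  (2 * a.2%:Z * (absz (mixer_pos a.1))%:Z - a.2%:Z ^+ 2)%:~R.
have inv0 : max_inv 0 (1%g, 0%N) by split.
have G0 : 0 <= V t G (1%g, 0%N).
  have := @walk_mean_drift_ge_in R _ max_next max_inv max_inv_next G 0 (1%g, 0%N) t.
  rewrite mul0r addr0 [G _](_ : _ = 0) //; apply => // s [g m] [/= gm _ _].
  rewrite step_mean_max mixer_step_meanE /G /= !addr0.
  have /= := max_submartingale gm; rewrite -(ler_int R) rmorphM rmorphD /=.
  by rewrite !(maxn_idPl gm); lra.
have : V t G (1%g, 0%N) <=
    V t (fun a => 2 * (mixer_pos a.1)%:~R ^+ 2 + (- 2^-1) * a.2%:R ^+ 2) (1%g, 0%N).
  apply: walk_mean_le => -[g m]; rewrite /G /=.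
  have -> : (mixer_pos g)%:~R ^+ 2 = (absz (mixer_pos g))%:R ^+ 2 :> R.
    by rewrite natr_absz intr_norm real_normK ?num_real.
  rewrite rmorphB !rmorphM /= -!pmulrn.
  move: (absz _)%:R (m%:R) => x y.
  by have := sqr_ge0 (2 * x - y : R); lra.
rewrite walk_meanD !walk_meanZ.
rewrite (max_next_lump t (fun g => (mixer_pos g)%:~R ^+ 2)) walk_pos2.
by move: G0; lra.
Qed.

Lemma walk_len_le t (q : R) : 1 <= q -> t%:R = q ^+ 4 ->
  W t (fun g => (len g)%:R) 1%g <= 39 * q ^+ 3.
Proof.
move=> q1 tq; have q0 : 0 < q by lra.
rewrite -(max_next_lump t (fun g => (len g)%:R) (1%g, 0%N)).
(* This window contains the random windows [Zm] below, since the maximum is at most [t]. *)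
pose Z := [seq - t.+1%:Z + i%:Z | i <- iota 0 t.*2.+3].
have uZ : uniq Z by rewrite map_inj_uniq ?iota_uniq // => i j /addrI [].
have : V t (fun a => (len a.1)%:R) (1%g, 0%N) <=
    V t (fun a => (6 * a.2%:R + 6) + ((1 + q / 4) * (6 * a.2%:R + 9) +
      3 / (4 * q) * \sum_(z <- Z) X z a.1 ^+ 2)) (1%g, 0%N).
  apply: (@walk_mean_le_in _ _ _ max_inv max_inv_next); last by split.
  move=> [[x s] m] [/= xm mt sm]; have := len_le xm sm.
  rewrite -(ler_nat R) natrD !natrM -[m.+1%:R]natr1 natr_sum.
  move=> /le_trans -> //.
  pose Zm := [seq - m.+1%:Z + i%:Z | i <- iota 0 m.*2.+3].
  have uZm : uniq Zm by rewrite map_inj_uniq ?iota_uniq // => i j /addrI [].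
  set D := \sum_(_ <= _ < _) _.
  have DE : D <= \sum_(z <- Zm) ((1 + q / 4) + 1 / (4 * q) * X z (Mixer x s) ^+ 2).
    rewrite /D big_map; apply: ler_sum => i _.
    have [_] := displacement_tile_state (- m.+1%:Z + i%:Z) (Mixer x s).
    set y := X _ _; set e := _%:R => /= ey.
    (* AM-GM with weight [q]: a displacement is at most [|y| / 2 + 1 <= 1 + q / 4 + y^2 / (4 q)]. *)
    have : 0 <= (`|y| - q) ^+ 2 / (4 * q).
      by rewrite divr_ge0 ?sqr_ge0 // mulr_ge0 // ltW.
    have -> : (`|y| - q) ^+ 2 / (4 * q) = q / 4 - `|y| / 2 + 1 / (4 * q) * y ^+ 2.
      by rewrite -(real_normK (num_real y)); field; rewrite gt_eqF.
    rewrite /= in ey; lra.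
  have sumZ : \sum_(z <- Zm) X z (Mixer x s) ^+ 2 <= \sum_(z <- Z) X z (Mixer x s) ^+ 2.
    apply: ler_sum_uniq => // [z|z /mapP[i]]; first exact: sqr_ge0.
    rewrite mem_iota => im ->; apply/mapP.
    by exists (absz (t.+1%:Z - m.+1%:Z + i%:Z)%R); rewrite ?mem_iota; lia.
  move: DE; rewrite big_split -mulr_sumr big_const_seq count_predT size_map size_iota.
  rewrite iter_addr_0 -(mulr_natr _ m.*2.+3).
  rewrite -[m.*2.+3]addn3 -[m.*2]muln2 natrD natrM /=.
  have q4 : 0 <= 1 / (4 * q) by rewrite divr_ge0 // mulr_ge0 // ltW.
  have := ler_wpM2l q4 sumZ.
  move: (\sum_(_ <- Z) _) (\sum_(_ <- Zm) _) => S Sm; lra.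
rewrite !(walk_meanD, walk_meanZ, walk_mean_cst).
move=> /le_trans -> //.
have M_le : V t (fun a => a.2%:R) (1%g, 0%N) <= 3 / 2 * q ^+ 2.
  (* AM-GM again, now at the scale [q^2] of the maximum. *)
  have : V t (fun a => 2 * q ^+ 2 * a.2%:R) (1%g, 0%N) <=
      V t (fun a => q ^+ 4 + a.2%:R ^+ 2) (1%g, 0%N).
    apply: walk_mean_le => -[g m] /=; have := sqr_ge0 (q ^+ 2 - m%:R).
    by rewrite -[4%N]/(2 * 2)%N exprM; lra.
  rewrite walk_meanD walk_meanZ walk_mean_cst; have := walk_max2 t; rewrite tq.
  move: (V _ _ _) (V _ _ _) => M2 M M2le Mle.
  rewrite -(ler_pM2l (_ : 0 < 2 * q ^+ 2)); last by rewrite mulr_gt0 ?exprn_gt0.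
  by lra.
have X2_le : 3 / (4 * q) * V t (fun a => \sum_(z <- Z) X z a.1 ^+ 2) (1%g, 0%N) <=
    3 / 2 * q ^+ 3.
  have -> : 3 / 2 * q ^+ 3 = 3 / (4 * q) * (2 * t%:R).
    by rewrite tq; field; rewrite gt_eqF.
  rewrite ler_wpM2l ?divr_ge0 ?mulr_ge0 ?(ltW q0) //.
  rewrite (max_next_lump t (fun g => \sum_(z <- Z) X z g ^+ 2)).
  exact: walk_tile_coord2.
have q2 : q <= q ^+ 2 by rewrite expr2 ler_peMr // ltW.
have q3 : q ^+ 2 <= q ^+ 3 by rewrite [q ^+ 3]exprS ler_peMl // exprn_ge0 // ltW.
have : (1 + q / 4) * (6 * V t (fun a => a.2%:R) (1%g, 0%N) + 9) <=
    (1 + q / 4) * (9 * q ^+ 2 + 9) by apply: ler_wpM2l; lra.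
(* Lower powers of [q] are at most [q^3], and the coefficients sum to 39:
   [9 + 6 + 9 + 9 + 9/4 + 9/4 + 3/2]. *)
by move: M_le X2_le; move: (V _ _ _) (_ / _ * V _ _ _) => M S; lra.
Qed.

End maximum.
End bounds.

(** For [q] below [N = 64 * 256], [q^3] is at most [N^3] and the mean length at least 1/2, as
    [1 <= q] excludes [t = 0]. *)
Lemma mean_len_bounds (R : realType) (t : nat) (q : R) : 1 <= q -> t%:R = q ^+ 4 ->
  q ^+ 3 <= 64 * (64 * 256) ^+ 3 * walk_mean mixer_next t (fun g => (len g)%:R) 1%g
  /\ walk_mean mixer_next t (fun g => (len g)%:R) 1%g <= 39 * q ^+ 3.
Proof.
move=> q1 tq; split; last exact: walk_len_le.
have N1 : 1 <= 64 * 256 :> R by lra.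
have := @walk_len_ge R t q; move: N1.
have : 2^-1 <= walk_mean mixer_next t (fun g => (len g)%:R : R) 1%g.
  case: t tq => [|t _]; last exact: walk_len_ge_half.
  by move/esym/eqP; rewrite expf_eq0 /= gt_eqF //; lra.
move: (64 * 256) (walk_mean _ _ _ _) => N w w2 N1 H.
have [qN|qN] := leP N q.
  apply: le_trans (H qN tq) _; rewrite ler_wpM2r //; first by lra.
  by rewrite ler_wpM2l // ler_eXnr.
have q3 : q ^+ 3 <= N ^+ 3 by apply: lerXn2r; rewrite ?nnegrE; lra.
have N3 : 0 <= N ^+ 3 by rewrite exprn_ge0 //; lra.
apply: le_trans q3 _; nra.
Qed.

Theorem theorem2p1 (R : realType) :
  exists c C : R, [/\ 0 < c, 0 < C &
    forall (d : measure_display) (T : measurableType d) (P : probability T R)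
      (omega : nat -> T -> mixer_group),
      mixer_chain P omega ->
      forall t : nat,
        ((c * t%:R `^ (3 / 4))%:E
           <= 'E_P[fun w => (mixer_dist (omega t w) 1%g)%:R])%E /\
        ('E_P[fun w => (mixer_dist (omega t w) 1%g)%:R]
           <= (C * t%:R `^ (3 / 4))%:E)%E].
Proof.
have N0 : 0 < 64 * (64 * 256) ^+ 3 :> R by rewrite mulr_gt0 ?exprn_gt0 ?mulr_gt0.
exists (64 * (64 * 256) ^+ 3)^-1, 39; split; rewrite ?invr_gt0 // => d T P omega.
move=> [upsilon [indep unif omega0 omegaS]] t.
rewrite (expectation_omega indep unif omega0 omegaS t (f := fun g => (len g)%:R)) //.
rewrite !lee_fin.
case: t => [|t].
  (* At time 0 all three quantities vanish, the power of 0 with nonzero exponent being 0. *)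
  by rewrite /= len1 powR0 ?mulr0 //; lra.
pose q : R := t.+1%:R `^ (1 / 4).
have q1 : 1 <= q.
  by rewrite -[1](powRr0 (t.+1%:R : R)) ler_powR ?ler1n // divr_ge0.
have tq : t.+1%:R = q ^+ 4.
  by rewrite -powR_mulrn ?powR_ge0 // -powRrM divfK // powRr1.
have -> : t.+1%:R `^ (3 / 4) = q ^+ 3.
  by rewrite -powR_mulrn ?powR_ge0 // -powRrM mulrAC mul1r.
have [lo hi] := mean_len_bounds q1 tq; split => //.
by rewrite ler_pdivrMl.
Qed.
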